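(* Let $n\ge 2$ and let $K$ be a field with $\mathrm{char}(K)>n$ or $\mathrm{char}(K)=0$. Let $A,B\in M_n(K)$ be such that $[A,B]=f(A)$, where $f$ is a polynomial with coefficients in $K$. Then $A,B$ are simultaneously triangularizable over the algebraic closure $\overline{K}$ of $K$.
   Context: $[A,B]=AB-BA$. Two matrices $A,B\in M_n(K)$ are simultaneously triangularizable over a field $L\supseteq K$ if there exists $P\in GL_n(L)$ such that $P^{-1}AP$ and $P^{-1}BP$ are both upper triangular. *)

(* Defs.v *)
From mathcomp Require Import all_boot all_order all_algebra.

Set Implicit Arguments.
Unset Strict Implicit.
Unset Printing Implicit Defensive.

Import GRing.Theory.
Local Open Scope ring_scope.

(* Algebraic closedness is taken as a property of a plain fieldType, since
   closedFieldType also carries a decision procedure for the first-order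
   theory of the field. *)
Definition is_algebraic_closure (K L : fieldType) (iota : {rmorphism K -> L}) :
    Prop :=
  GRing.closed_field_axiom L /\ (forall x : L, algebraicOver iota x).

(* is_trig_mx denotes lower triangular matrices, hence the transpose. *)
Definition is_upper_trig_mx (R : nmodType) (n : nat) (M : 'M[R]_n) : bool :=
  is_trig_mx M^T.

(* The extension of K by L is given by the (injective) morphism iota. *)
Definition simultaneously_triangularizable (K L : fieldType)
    (iota : {rmorphism K -> L}) (n : nat) (A B : 'M[K]_n) : Prop :=
  exists P : 'M[L]_n,
    [/\ P \in unitmx,
        is_upper_trig_mx (invmx P *m map_mx iota A *m P) &
        is_upper_trig_mx (invmx P *m map_mx iota B *m P)].

(* Main.v *)
Require Import Defs.
From mathcomp Require Import all_boot all_order all_algebra.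

Set Implicit Arguments.
Unset Strict Implicit.
Unset Printing Implicit Defensive.

Import GRing.Theory.
Local Open Scope ring_scope.

(** The commutator with B is a derivation, and its value f(A) at A commutes
    with A; hence [p(A), B] = p'(A) f(A) for every polynomial p
    ([commutator_horner_mx]). Applied to the minimal polynomial m of A, this
    makes m divide m' f. A root a of m has a multiplicity k between 1 and the
    size of A, so k is nonzero in the field, and a is a root of m' of
    multiplicity exactly k - 1; the missing factor must come from f
    ([root_of_dvdp_deriv]). So f vanishes at every eigenvalue a of A
    ([eigenvalue_root_commutator]).

    On the eigenspace E of A for a, the commutator f(A) acts as f(a) = 0, so
    B maps E to itself and has an eigenvector there when the field is
    algebraically closed: A and B share an eigenvector
    ([common_eigenvector]). In a basis starting with it both matrices are block
    triangular, and the complementary diagonal blocks satisfy the same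
    commutator relation with the same f, in a smaller size. Induction on
    the size concludes ([common_lower_trig]).

    Since matrices act here on row vectors, the induction yields lower triangular
    forms. Upper triangular ones come from the transposes of A and B,
    which satisfy the relation with - f in place of f. *)

Lemma horner_mx_tr (R : comNzRingType) (n : nat) (A : 'M[R]_n.+1)
    (p : {poly R}) :
  horner_mx A^T p = (horner_mx A p)^T.
Proof.
elim/poly_ind: p => [|p c IHp]; first by rewrite !rmorph0 trmx0.
rewrite !(rmorphD, rmorphM) /= !(horner_mx_X, horner_mx_C) linearD /=.
rewrite tr_scalar_mx IHp -!mulmxE -trmx_mul.
by rewrite (comm_mx_horner p (erefl (A *m A))).
Qed.

(** This is how the commutator relation descends to the diagonal block. *)
Lemma horner_mx_lblock (R : comNzRingType) (n : nat) (a : 'M[R]_1)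
    (c : 'M[R]_(n.+1, 1)) (A : 'M[R]_n.+1) (p : {poly R}) :
  exists (u : 'M[R]_1) (v : 'M[R]_(n.+1, 1)),
    horner_mx (block_mx a 0 c A : 'M[R]_(1 + n.+1)) p =
    block_mx u 0 v (horner_mx A p).
Proof.
elim/poly_ind: p => [|p k [u [v IHp]]].
  by exists 0, 0; rewrite !rmorph0 block_mx0.
rewrite !(rmorphD, rmorphM) /= !(horner_mx_X, horner_mx_C) IHp.
rewrite (@scalar_mx_block _ 1 n.+1) -!mulmxE.
rewrite (@mulmx_block _ 1 n.+1 1 n.+1 1 n.+1).
rewrite (@add_block_mx _ 1 n.+1 1 n.+1) !(mul0mx, mulmx0, addr0, add0r).
by do 2!eexists.
Qed.

(** The chain rule for the derivation X |-> [X, B]: the factors f(A) that it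
    produces commute with A, so they can be collected on the right. *)
Lemma commutator_horner_mx (R : comNzRingType) (n : nat) (A B : 'M[R]_n.+1)
    (f p : {poly R}) :
  A *m B - B *m A = horner_mx A f ->
  horner_mx A p *m B - B *m horner_mx A p = horner_mx A (p^`() * f).
Proof.
move=> AB; elim/poly_ind: p => [|p c IHp].
  by rewrite deriv0 mul0r rmorph0 mul0mx mulmx0; apply: subrr.
rewrite derivD derivM derivX derivC addr0 mulr1.
have -> : (p^`() * 'X + p) * f = (p^`() * f) * 'X + p * f.
  by rewrite mulrDl mulrAC.
rewrite !(rmorphD, rmorphM) /= !(horner_mx_X, horner_mx_C).
rewrite -rmorphM /= -IHp -AB mulmxDl mulmxDr -scalar_mxC opprD addrACA.
rewrite subrr addr0 -!mulmxE mulmxBr mulmxBl !mulmxA [RHS]addrC.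
by rewrite addrA subrK.
Qed.

(** Multiplicities at a drop by exactly one from p to p^`(), because the
    hypothesis makes the multiplicity of a in p nonzero in F; f has to supply
    the missing factor 'X - a. *)
Lemma root_of_dvdp_deriv (F : fieldType) (p f : {poly F}) (a : F) :
  p != 0 -> (forall k, (0 < k < size p)%N -> k%:R != 0 :> F) ->
  p %| p^`() * f -> root p a -> root f a.
Proof.
move=> p0 natF pf pa; have [k [q]] := multiplicity_XsubC p a.
rewrite p0 /= => qa Dp.
have q0 : q != 0 by apply: contraNneq qa => ->; rewrite root0.
case: k Dp => [|k] Dp; first by rewrite Dp mulr1 (negPf qa) in pa.
(* q is nonzero, so the multiplicity k.+1 is at most the degree of p. *)
have size_k : (k.+1 < size p)%N.
  rewrite Dp size_Mmonic ?monic_exp ?monicXsubC // size_exp_XsubC addnS /=.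
  by rewrite -[X in (X < _)%N]add0n -addSn leq_add2r size_poly_gt0.
have Dp' : p^`() = (q^`() * ('X - a%:P) + q *+ k.+1) * ('X - a%:P) ^+ k.
  rewrite Dp derivM deriv_exp derivXsubC mul1r /= exprS [RHS]mulrDl -mulrA.
  by rewrite mulrnAr mulrnAl.
have : q * ('X - a%:P) %| (q^`() * ('X - a%:P) + q *+ k.+1) * f.
  rewrite -(@dvdp_mul2r _ (('X - a%:P) ^+ k)) ?expf_neq0 ?polyXsubC_eq0 //.
  by rewrite -mulrA -exprS -Dp mulrAC -Dp'.
(* Modulo 'X - a, the right-hand side is k.+1 q(a) f(a), in which only f(a)
   can vanish. *)
move=> /(dvdp_trans (dvdp_mull q (dvdpp _))); rewrite dvdp_XsubCl /root.
rewrite !hornerE subrr mulr0 add0r hornerMn -mulr_natr !mulf_eq0.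
by rewrite -/(root q a) (negPf qa) (negPf (natF _ _)).
Qed.

(** Applying [commutator_horner_mx] to the minimal polynomial m of A gives
    0 = m'(A) f(A), that is, m divides m' f. *)
Lemma eigenvalue_root_commutator (F : fieldType) (n : nat) (A B : 'M[F]_n.+1)
    (f : {poly F}) (a : F) :
  (forall k, (0 < k <= n.+1)%N -> k%:R != 0 :> F) ->
  A *m B - B *m A = horner_mx A f -> eigenvalue A a -> root f a.
Proof.
move=> natF AB; rewrite eigenvalue_root_min.
apply: root_of_dvdp_deriv; first exact/monic_neq0/mxminpoly_monic.
  move=> k /andP[k_gt0 lt_k]; apply: natF; rewrite k_gt0 -ltnS.
  apply: leq_trans lt_k _; rewrite -(size_char_poly A) dvdp_leq //.
    exact/monic_neq0/char_poly_monic.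
  exact: mxminpoly_dvd_char.
apply: mxminpoly_min; rewrite -(commutator_horner_mx _ AB).
by rewrite mx_root_minpoly mul0mx mulmx0 subrr.
Qed.

Lemma horner_mx_eigenvector (R : comNzRingType) (m n : nat)
    (A : 'M[R]_n.+1) (V : 'M[R]_(m, n.+1)) (a : R) (p : {poly R}) :
  V *m A = a *: V -> V *m horner_mx A p = p.[a] *: V.
Proof.
move=> VA; elim/poly_ind: p => [|p c IHp].
  by rewrite rmorph0 mulmx0 horner0 scale0r.
rewrite !(rmorphD, rmorphM) /= horner_mx_X horner_mx_C hornerMXaddC.
by rewrite mulmxDr mulmxA IHp -scalemxAl VA scalerA mul_mx_scalar scalerDl.
Qed.

Lemma eigenvalue_exists (F : fieldType) (n : nat) (A : 'M[F]_n.+1) :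
  GRing.closed_field_axiom F -> exists a, eigenvalue A a.
Proof.
move=> closedF.
have /(PreClosedField.closed_rootP closedF)[a pa] : size (char_poly A) != 1%N.
  by rewrite size_char_poly.
by exists a; rewrite eigenvalue_root_char.
Qed.

(** Any eigenspace of A will do: it is stable by B because f(A) vanishes
    on it. *)
Lemma common_eigenvector (F : fieldType) (n : nat) (A B : 'M[F]_n.+1)
    (f : {poly F}) :
  GRing.closed_field_axiom F ->
  (forall k, (0 < k <= n.+1)%N -> k%:R != 0 :> F) ->
  A *m B - B *m A = horner_mx A f ->
  exists2 v : 'rV[F]_n.+1, v != 0 &
    exists a b, v *m A = a *: v /\ v *m B = b *: v.
Proof.
move=> closedF natF AB; have [a Aa] := eigenvalue_exists A closedF.
have fa := eigenvalue_root_commutator natF AB Aa.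
pose E := eigenspace A a.
have EA : E *m A = a *: E by apply/eigenspaceP.
have EB : stablemx E B.
  (* E B A = E A B - E f(A), where E f(A) = f(a) E = 0. *)
  apply/eigenspaceP; rewrite -/E; move: (E) EA => W WA; apply/eqP.
  rewrite scalemxAl -WA -subr_eq0 -!mulmxA -mulmxBr -opprB AB mulmxN.
  by rewrite (horner_mx_eigenvector f WA) (rootP fa) scale0r oppr0.
(* The restriction of B to E needs a size of successor form. *)
have [m rankE] : exists m, \rank E = m.+1.
  by exists (\rank E).-1; rewrite prednK // lt0n mxrank_eq0.
pose V := row_base E.
have [b Bb] : exists b, eigenvalue (conjmx V B) b.
  by move: (conjmx V B); rewrite rankE => C; apply: eigenvalue_exists.
have [w wB w0] := eigenvalueP Bb.
have V_free : row_free V := row_base_free E.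
have VB : stablemx V B by rewrite stablemx_row_base.
exists (w *m V); first by rewrite mulmx_free_eq0.
exists a, b; split; apply/eigenspaceP.
  by rewrite mulmx_sub // eq_row_base.
by rewrite -sub_eigenspace_conjmx //; apply/eigenspaceP.
Qed.

(** Gaussian elimination completes v to a basis up to a scalar: since v has
    rank 1, it is a multiple of the first row of its extended row basis. *)
Lemma unit_first_row (F : fieldType) (n : nat) (v : 'rV[F]_(1 + n)) :
  v != 0 -> exists2 P : 'M[F]_(1 + n), P \in unitmx & usubmx P = v.
Proof.
move=> v0; have rank_v : \rank v = 1%N by apply/eqP; rewrite rank_rV v0.
have [c c0 Dv] : exists2 c : F, c != 0 &
    v = c *: usubmx (row_ebase v : 'M_(1 + n)).
  exists (col_ebase v 0 0).
    by have := col_ebase_unit v; rewrite unitmxE det_mx11 unitfE.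
  rewrite -{1}[v]mulmx_ebase rank_v [col_ebase v]mx11_scalar mul_scalar_mx.
  rewrite -scalemxAl -[row_ebase v in LHS](@vsubmxK _ 1 n).
  by rewrite pid_mx_row mul_row_col mul1mx mul0mx addr0 !mxE.
exists (c *: (row_ebase v : 'M_(1 + n))); last by rewrite linearZ.
by rewrite unitmxZ ?unitfE ?row_ebase_unit.
Qed.

(** Induction on the size: a common eigenvector, taken as first basis vector,
    splits off a block of size 1. *)
Lemma common_lower_trig (F : fieldType) (n : nat) (A B : 'M[F]_n.+1)
    (f : {poly F}) :
  GRing.closed_field_axiom F ->
  (forall k, (0 < k <= n.+1)%N -> k%:R != 0 :> F) ->
  A *m B - B *m A = horner_mx A f ->
  exists P : 'M[F]_n.+1,
    [/\ P \in unitmx, is_trig_mx (P *m A *m invmx P) &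
        is_trig_mx (P *m B *m invmx P)].
Proof.
move=> closedF; elim: n A B => [|n IHn] A B natF AB.
  by exists 1%:M; split; rewrite ?unitmx1 ?mx11_is_trig.
have [v v0 [a [b [vA vB]]]] := common_eigenvector closedF natF AB.
have [P Pu Pv] := unit_first_row v0.
have blockP (M : 'M[F]_(1 + n.+1)) c : v *m M = c *: v ->
    exists d (M' : 'M_n.+1), P *m M *m invmx P = block_mx c%:M 0 d M'.
  move=> vM; pose N : 'M_(1 + n.+1) := P *m M *m invmx P.
  exists (dlsubmx N), (drsubmx N).
  have uN : usubmx N = row_mx c%:M 0.
    rewrite /N -!mul_usub_mx Pv vM -scalemxAl -Pv mul_usub_mx mulmxV //.
    rewrite (@scalar_mx_block _ 1 n.+1) /block_mx col_mxKu scale_row_mx scaler0.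
    by rewrite scalemx1.
  by rewrite -/N -[LHS]submxK /ulsubmx /ursubmx uN row_mxKl row_mxKr.
have [c [A' DA]] := blockP _ _ vA; have [d [B' DB]] := blockP _ _ vB.
have AB' : A' *m B' - B' *m A' = horner_mx A' f.
  have : (P *m A *m invmx P) *m (P *m B *m invmx P) -
         (P *m B *m invmx P) *m (P *m A *m invmx P) =
         horner_mx (P *m A *m invmx P) f.
    by rewrite horner_mx_uconj // -AB mulmxBr mulmxBl !mulmxA !mulmxKV.
  rewrite DA DB; have [u [w ->]] := horner_mx_lblock a%:M c A' f.
  rewrite !mulmx_block opp_block_mx add_block_mx => /eq_block_mx[_ _ _].
  by rewrite !mulmx0 !add0r.
have [|Q [Qu QA QB]] := IHn A' B' _ AB'.
  by move=> k /andP[k0 lk]; rewrite natF // k0 ltnW.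
pose R : 'M_(1 + n.+1) := block_mx 1%:M 0 0 Q.
have Ru : R \in unitmx by rewrite unitmxE det_lblock det1 mul1r -unitmxE.
have RV : invmx R = block_mx 1%:M 0 0 (invmx Q).
  by rewrite invmx_block_diag // invmx1.
have trigR (x : F) y (M' : 'M[F]_n.+1) : is_trig_mx (Q *m M' *m invmx Q) ->
    is_trig_mx (R *m block_mx x%:M 0 y M' *m invmx R).
  move=> QM; rewrite RV !mulmx_block !(mul0mx, mulmx0, addr0, add0r).
  by rewrite is_trig_block_mx // eqxx mx11_is_trig.
have conjRP (M : 'M[F]_(1 + n.+1)) :
    R *m P *m M *m invmx (R *m P) = R *m (P *m M *m invmx P) *m invmx R.
  by rewrite -!conjumx ?unitmx_mul ?Ru ?conjuMumx.
exists (R *m P); split; first by rewrite unitmx_mul Ru.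
  by rewrite conjRP DA trigR.
by rewrite conjRP DB trigR.
Qed.

Theorem theorem3 (n : nat) (K L : fieldType) (iota : {rmorphism K -> L})
  (A B : 'M[K]_n.+1) (f : {poly K}) :
  (2 <= n.+1)%N ->
  [pchar K] =i pred0 \/ (exists2 p : nat, p \in [pchar K] & (n.+1 < p)%N) ->
  is_algebraic_closure iota ->
  A *m B - B *m A = horner_mx A f ->
  simultaneously_triangularizable iota A B.
Proof.
move=> _ charK [closedL _] AB.
have natL k : (0 < k <= n.+1)%N -> k%:R != 0 :> L.
  case/andP=> k_gt0 le_k; rewrite -(rmorph_nat iota) fmorph_eq0.
  case: charK => [char0 | [p charp lt_p]].
    by apply/negP => /(natf0_pchar k_gt0)[p]; rewrite char0.
  rewrite -(dvdn_pcharf charp); apply/negP => /(dvdn_leq k_gt0).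
  by rewrite leqNgt (leq_ltn_trans le_k).
pose Ai := map_mx iota A; pose Bi := map_mx iota B.
have ABt : Ai^T *m Bi^T - Bi^T *m Ai^T = horner_mx Ai^T (- map_poly iota f).
  rewrite rmorphN /= horner_mx_tr -map_horner_mx -AB map_mxB !map_mxM.
  by rewrite linearB /= !trmx_mul opprB.
have [P [Pu PA PB]] := common_lower_trig closedL natL ABt.
exists P^T; rewrite unitmx_tr /is_upper_trig_mx -!trmx_inv.
by split; rewrite // !trmx_mul !trmxK mulmxA.
Qed.
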